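(* Let $\{\psi(\theta,S),\ \theta,S\in T_0\}$ be a biadmissible family. For each $S\in T_0$ let $$v(S)=\operatorname{ess\,sup}_{\tau_1,\tau_2\in T_S}E[\psi(\tau_1,\tau_2)\mid\mathcal F_S].$$ For each stopping time $\theta\in T_0$ let $$u_1(\theta)=\operatorname{ess\,sup}_{\tau_1\in T_\theta}E[\psi(\tau_1,\theta)\mid\mathcal F_\theta],\qquad u_2(\theta)=\operatorname{ess\,sup}_{\tau_2\in T_\theta}E[\psi(\theta,\tau_2)\mid\mathcal F_\theta],\qquad \phi(\theta)=\max[u_1(\theta),u_2(\theta)],$$ and for each $S\in T_0$ let $$u(S)=\operatorname{ess\,sup}_{\theta\in T_S}E[\phi(\theta)\mid\mathcal F_S].$$ Then, for each $S\in T_0$, $v(S)=u(S)$ a.s.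
   Context: Let $T\in[0,\infty)$ be a fixed constant and let $(\Omega,\mathcal F,(\mathcal F_t)_{0\le t\le T},P)$ be a filtered probability space with $\mathcal F=\mathcal F_T$, whose filtration satisfies the usual conditions (right continuity and augmentation by the null sets of $\mathcal F$), and such that $\mathcal F_0$ contains only sets of probability $0$ or $1$. $T_0$ denotes the set of stopping times with values in $[0,T]$. For $S\in T_0$, $T_S$ denotes the set of $\theta\in T_0$ with $S\le\theta$ a.s. A family $\{\psi(\theta,S),\theta,S\in T_0\}$ is biadmissible if (1) for all $\theta,S\in T_0$, $\psi(\theta,S)$ is a nonnegative $\mathcal F_{\theta\vee S}$-measurable random variable; (2) for all $\theta,\theta',S,S'\in T_0$, $\psi(\theta,S)=\psi(\theta',S')$ a.s. on $\{\theta=\theta'\}\cap\{S=S'\}$. No integrability is assumed; conditional expectations of nonnegative random variables and essential suprema are understood with values in $[0,+\infty]$. *)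

(* Defs.v *)
From HB Require Import structures.
From mathcomp Require Import all_boot all_order all_algebra.
From mathcomp Require Import all_classical all_reals all_analysis.
From mathcomp Require Import measurable_realfun.

Set Implicit Arguments.
Unset Strict Implicit.
Unset Printing Implicit Defensive.
Import Order.TTheory GRing.Theory Num.Theory.
Import numFieldNormedType.Exports.
Local Open Scope classical_set_scope.
Local Open Scope ring_scope.

Section random_variables.
Context {R : realType} {d : measure_display} {Omega : measurableType d}.
Variable P : probability Omega R.
Implicit Types (G : set (set Omega)) (X Y Z : Omega -> \bar R).

(* For G a sigma-algebra, g_sigma_algebraType G is Omega equipped with G. *)
Definition nonneg_rv G Y : Prop :=
  measurable_fun [set: g_sigma_algebraType G] Y /\
  forall w, (0 <= Y w)%E.

Definition is_cond_exp G X Y : Prop :=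
  nonneg_rv G Y /\
  forall A, G A -> (\int[P]_(w in A) Y w = \int[P]_(w in A) X w)%E.

(* A version of E[X | G], for G a sub-sigma-algebra and X a nonnegative random
   variable: one exists and it is a.s. unique, so the default is irrelevant. *)
Definition cond_exp G X : Omega -> \bar R :=
  xget (cst 0%E) [set Y | is_cond_exp G X Y].

(* Essential supremum of a family of random variables, in the sense of the
   almost sure order (ess_sup of the library is the essential supremum of a
   single function).  No cardinality assumption is made on the family. *)
Definition is_esssup (K : set (Omega -> \bar R)) Y : Prop :=
  [/\ nonneg_rv measurable Y,
      forall X, K X -> \forall w \ae P, (X w <= Y w)%E
    & forall Z, nonneg_rv measurable Z ->
        (forall X, K X -> \forall w \ae P, (X w <= Z w)%E) ->
        \forall w \ae P, (Y w <= Z w)%E].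

(* As for cond_exp: existence holds for every family of [0,+oo]-valued random
   variables, with a.s. uniqueness. *)
Definition esssup (K : set (Omega -> \bar R)) : Omega -> \bar R :=
  xget (cst 0%E) [set Y | is_esssup K Y].

End random_variables.

Section stopping.
Context {R : realType} {d : measure_display} {Omega : measurableType d}.
Variables (P : probability Omega R) (T : R) (F : R -> set (set Omega)).
Implicit Types S theta tau : Omega -> R.

(* Only the values F t with 0 <= t <= T are relevant. *)
Record filtration : Prop := Filtration {
  filtration_sigma : forall t, 0 <= t <= T -> sigma_algebra setT (F t);
  filtration_homo : forall s t, 0 <= s -> s <= t -> t <= T -> F s `<=` F t;
  filtration_last : F T = measurable
}.

Record usual_conditions : Prop := UsualConditions {
  right_continuous : forall t, 0 <= t < T -> F t = \bigcap_(s in `]t, T]) F s;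
  augmented : forall N, measurable N -> P N = 0%E -> F 0 N
}.

Definition T0 : set (Omega -> R) := [set tau |
  (forall w, 0 <= tau w <= T) /\
  (forall t, 0 <= t <= T -> F t [set w | tau w <= t])].

Definition Tfrom S : set (Omega -> R) :=
  [set theta | T0 theta /\ \forall w \ae P, S w <= theta w].

(* The sigma-algebra of events prior to the stopping time tau. *)
Definition Fstop tau : set (set Omega) := [set A |
  F T A /\ forall t, 0 <= t <= T -> F t (A `&` [set w | tau w <= t])].

(* Only the values psi theta S at stopping times are relevant. *)
Definition biadmissible
    (psi : (Omega -> R) -> (Omega -> R) -> Omega -> \bar R) : Prop :=
  (forall theta S, T0 theta -> T0 S ->
     nonneg_rv (Fstop (fun w => Num.max (theta w) (S w))) (psi theta S)) /\
  (forall theta theta' S S', T0 theta -> T0 theta' -> T0 S -> T0 S' ->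
     \forall w \ae P, theta w = theta' w -> S w = S' w ->
       psi theta S w = psi theta' S' w).

Section values.
Variable psi : (Omega -> R) -> (Omega -> R) -> Omega -> \bar R.

Definition v S := esssup P
  [set cond_exp P (Fstop S) (psi tau1 tau2) |
    tau1 in Tfrom S & tau2 in Tfrom S].

Definition u1 theta := esssup P
  [set cond_exp P (Fstop theta) (psi tau1 theta) | tau1 in Tfrom theta].

Definition u2 theta := esssup P
  [set cond_exp P (Fstop theta) (psi theta tau2) | tau2 in Tfrom theta].

Definition phi theta : Omega -> \bar R :=
  fun w => maxe (u1 theta w) (u2 theta w).

Definition u S := esssup P
  [set cond_exp P (Fstop S) (phi theta) | theta in Tfrom S].

End values.
End stopping.

(* Main.v *)
From HB Require Import structures.
Require Import Defs.
From mathcomp Require Import all_boot all_order all_algebra.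
From mathcomp Require Import all_classical all_reals all_analysis.
From mathcomp Require Import measurable_realfun.
Set Implicit Arguments.
Unset Strict Implicit.
Unset Printing Implicit Defensive.
Import Order.TTheory GRing.Theory Num.Theory.
Import numFieldNormedType.Exports.
Local Open Scope classical_set_scope.
Local Open Scope ring_scope.

(** The two inequalities rest on different ideas.

    For v S <= u S, given stopping times tau1 and tau2 after S, put
    theta = min (tau1, tau2).  On {tau1 <= tau2} the reward psi tau1 tau2 equals
    psi theta tau2, so what is left after theta is a single stopping problem,
    bounded by u2 theta; on the complement it is bounded by u1 theta.  The event
    is known at time theta, hence E[psi tau1 tau2 | F_theta] <= phi theta, and
    conditioning further on F_S gives the bound (v_le_u).

    For u S <= v S, phi theta <= v theta is immediate (phi_le_v): stopping at
    theta one of the two times is admissible for v theta.  It remains that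
    E[v theta | F_S] <= v S (v_supermartingale).  Pasting two pairs of stopping
    times along the F_theta-event where the first is conditionally better shows
    that the conditional rewards at theta are upward directed
    (cond_exp_psi_directed); v theta is then the limit of an increasing sequence
    of them, and monotone convergence reduces the claim to one pair at a time,
    where it is the tower property.

    Both arguments work with the characterization of conditional expectations
    and essential suprema, so they need the existence of both.  Conditional
    expectations of bounded variables are Radon-Nikodym derivatives with respect
    to the restriction of P, and the general case is the supremum over
    truncations (cond_expP).  The essential supremum of a nonempty family is the
    supremum of a countable subfamily chosen by exhaustion (is_esssup_supn).
    Almost sure inequalities between G-measurable variables are always obtained
    by comparing integrals over the events of G (ae_le_of_integral). *)

(** * Integrals over the events of a sub-sigma-algebra *)

Section conditional_expectation.
Context {R : realType} {d : measure_display} {Omega : measurableType d}.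
Variable P : probability Omega R.
Implicit Types (G : set (set Omega)) (X Y Z : Omega -> \bar R) (A B : set Omega).

Definition sub_sigma_algebra_of G : Prop :=
  sigma_algebra [set: Omega] G /\ G `<=` measurable.

Lemma measurable_sub_sigma_algebra : sub_sigma_algebra_of measurable.
Proof. by split => //; exact: sigma_algebra_measurable. Qed.

Lemma sub_sigma_algebra_measurableE G : sub_sigma_algebra_of G ->
  (measurable : set (set (g_sigma_algebraType G))) = G.
Proof. by move=> [sG _]; exact: sigma_algebra_id. Qed.

Lemma sub_sigma_algebraI G A B : sub_sigma_algebra_of G ->
  G A -> G B -> G (A `&` B).
Proof.
move=> sG; rewrite -(sub_sigma_algebra_measurableE sG); exact: measurableI.
Qed.

Lemma sub_sigma_algebraC G A : sub_sigma_algebra_of G -> G A -> G (~` A).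
Proof.
move=> sG; rewrite -(sub_sigma_algebra_measurableE sG); exact: measurableC.
Qed.

Lemma sub_sigma_algebraU G A B : sub_sigma_algebra_of G ->
  G A -> G B -> G (A `|` B).
Proof.
move=> sG; rewrite -(sub_sigma_algebra_measurableE sG); exact: measurableU.
Qed.

Lemma nonneg_rv_measurableE Y :
  nonneg_rv measurable Y <->
  measurable_fun [set: Omega] Y /\ forall w, (0 <= Y w)%E.
Proof.
have E := sub_sigma_algebra_measurableE measurable_sub_sigma_algebra.
by split=> -[mY Y0]; split => // _ B mB; have := mY measurableT _ mB; rewrite E.
Qed.

Lemma nonneg_rvS G Y : sub_sigma_algebra_of G ->
  nonneg_rv G Y -> measurable_fun [set: Omega] Y.
Proof.
move=> sG [mY _] _ B mB; apply: (proj2 sG).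
rewrite -(sub_sigma_algebra_measurableE sG); exact: mY.
Qed.

Lemma nonneg_rvW G Y : sub_sigma_algebra_of G ->
  nonneg_rv G Y -> nonneg_rv measurable Y.
Proof.
move=> sG GY; apply/nonneg_rv_measurableE; split; first exact: nonneg_rvS GY.
by case: GY.
Qed.

(** The library's esups carries a starting index, which would always be 0 here. *)
Definition supn (X : nat -> Omega -> \bar R) : Omega -> \bar R :=
  fun w => ereal_sup (range (X ^~ w)).

Lemma supn_ub (X : nat -> Omega -> \bar R) n w : (X n w <= supn X w)%E.
Proof. by apply: ereal_sup_ubound; exists n. Qed.

Lemma supn_lub (X : nat -> Omega -> \bar R) w (z : \bar R) : (forall n, X n w <= z)%E -> (supn X w <= z)%E.
Proof. by move=> Xz; apply: ge_ereal_sup => _ [n _ <-]. Qed.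

Lemma nonneg_rv_supn G (X : nat -> Omega -> \bar R) :
  (forall n, nonneg_rv G (X n)) -> nonneg_rv G (supn X).
Proof.
move=> GX; split=> [|w]; last first.
  by apply: le_trans (supn_ub X 0%N w); case: (GX 0%N).
have := @measurable_fun_esups _ (g_sigma_algebraType G) R setT X
  (fun n => proj1 (GX n)) 0%N.
congr measurable_fun; apply/funext => w; rewrite /esups /supn/=; congr ereal_sup.
by apply/seteqP; split => [_ [n _ <-]|_ [n _ <-]]; exists n.
Qed.

Lemma integral_splitI X A B : measurable A -> measurable B ->
  nonneg_rv measurable X ->
  (\int[P]_(w in B) X w =
   \int[P]_(w in B `&` A) X w + \int[P]_(w in B `\` A) X w)%E.
Proof.
move=> mA mB /nonneg_rv_measurableE[mX X0].
rewrite -ge0_integral_setU//; last 4 first.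
- exact: measurableI.
- exact: measurableD.
- exact: measurable_funTS.
- rewrite disj_set2E; apply/eqP/seteqP; split => // w [[_ Aw] [_]]; exact.
by congr integral; rewrite setUIDK.
Qed.

Lemma le_integral_ae X Y B : measurable B ->
  nonneg_rv measurable X -> nonneg_rv measurable Y ->
  (\forall w \ae P, B w -> X w <= Y w)%E ->
  (\int[P]_(w in B) X w <= \int[P]_(w in B) Y w)%E.
Proof.
move=> mB /nonneg_rv_measurableE[mX X0] /nonneg_rv_measurableE[mY Y0] XY.
by apply: ae_ge0_le_integral => //; exact: measurable_funTS.
Qed.

(** On the event {Z < Y, Z <= n} of G the integral of Z is finite, so the
    hypothesis makes the integral of the positive function Y - Z vanish there and
    the event is null.  Since Z < Y forces Z to be finite, these events exhaust
    {Z < Y}. *)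
Lemma ae_le_of_integral G Y Z : sub_sigma_algebra_of G ->
  nonneg_rv G Y -> nonneg_rv G Z ->
  (forall A, G A -> \int[P]_(w in A) Y w <= \int[P]_(w in A) Z w)%E ->
  (\forall w \ae P, Y w <= Z w)%E.
Proof.
move=> sG GY GZ YZ.
have mY := nonneg_rvS sG GY; have mZ := nonneg_rvS sG GZ.
have [gY Y0] := GY; have [gZ Z0] := GZ.
pose A n := [set w | (Z w < Y w)%E] `&` [set w | (Z w <= n%:R%:E)%E].
have GA n : G (A n).
  apply: sub_sigma_algebraI => //; rewrite -(sub_sigma_algebra_measurableE sG).
    by have := @measurable_lte _ (g_sigma_algebraType G) R setT measurableT _ _ gZ gY;
      rewrite setTI.
  have := @measurable_lee _ (g_sigma_algebraType G) R setT measurableT _ _ gZ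
    (measurable_cst (n%:R%:E)).
  by rewrite setTI.
have mA n : measurable (A n) by exact: (proj2 sG).
have nA n : P.-negligible (A n).
  have Zfin : (\int[P]_(w in A n) Z w < +oo)%E.
    apply: (@le_lt_trans _ _ (\int[P]_(w in A n) (cst n%:R%:E) w)%E).
      apply: ge0_le_integral => //.
      - exact: measurable_funTS.
      - by move=> w [].
    rewrite integral_cst//; apply: lte_mul_pinfty => //.
    exact: le_lt_trans (probability_le1 P (mA n)) (ltry _).
  pose D w := (Y w - Z w)%E.
  have D0 w : A n w -> (0 < D w)%E.
    by move=> [ZY Zn]; rewrite /D sube_gt0.
  have mD : measurable_fun (A n) D.
    by apply: measurable_funTS; exact: emeasurable_funB.
  have E : (\int[P]_(w in A n) Y w =
            \int[P]_(w in A n) Z w + \int[P]_(w in A n) D w)%E.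
    rewrite -ge0_integralD//; last 2 first.
    - exact: measurable_funTS.
    - by move=> w /D0/ltW.
    apply: eq_integral => w; rewrite inE => -[ZY Zn].
    rewrite /D addeC subeK// ge0_fin_numE//.
    exact: le_lt_trans Zn (ltry _).
  have Zf : (\int[P]_(w in A n) Z w)%E \is a fin_num.
    by rewrite ge0_fin_numE//; exact: integral_ge0.
  have I0 : (\int[P]_(w in A n) `|D w| = 0)%E.
    rewrite (eq_integral D)/=; last first.
      by move=> w; rewrite inE => /D0/ltW/gee0_abs.
    apply/eqP; rewrite eq_le; apply/andP; split; last first.
      by apply: integral_ge0 => w /D0/ltW.
    have := YZ _ (GA n); rewrite E -[leRHS]adde0.
    by rewrite leeD2lE.
  have /(ae_eq_integral_abs P (mA n) mD) [N [mN N0 sN]] := I0.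
  exists N; split => // w Aw; apply: sN => /(_ Aw)/= DE.
  by have := D0 _ Aw; rewrite DE ltxx.
have : P.-negligible (\bigcup_n A n) by exact: negligible_bigcup.
apply: negligibleS => w /= /negP; rewrite -ltNge => ZY.
have Zf : Z w \is a fin_num.
  by rewrite ge0_fin_numE//; exact: lt_le_trans ZY (leey _).
exists (Num.truncn (fine (Z w))).+1 => //; split => //=.
by rewrite -(fineK Zf) lee_fin ltW// truncnS_gt.
Qed.


(** Monotone convergence for a family that is only almost surely upward directed:
    the running maxima of X increase to supn X everywhere, and each of them is
    almost surely below some Z whose integral is controlled. *)
Lemma integral_supn_le (X : nat -> Omega -> \bar R) B (c : \bar R) :
  measurable B -> (forall n, nonneg_rv measurable (X n)) ->
  (forall n, exists Z, [/\ nonneg_rv measurable Z,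
     forall i, (i <= n)%N -> \forall w \ae P, (X i w <= Z w)%E &
     (\int[P]_(w in B) Z w <= c)%E]) ->
  (\int[P]_(w in B) supn X w <= c)%E.
Proof.
move=> mB mX XZ.
(* The running maximum of X 0, ..., X n. *)
pose M := fix M n := if n is m.+1 then fun w => maxe (M m w) (X n w) else X 0%N.
have mM n : measurable_fun [set: Omega] (M n).
  elim: n => [|n IH]; first by case/nonneg_rv_measurableE: (mX 0%N).
  by apply: measurable_maxe => //; case/nonneg_rv_measurableE: (mX n.+1).
have M0 n w : (0 <= M n w)%E.
  elim: n => [|n IH]; first by have [_] := mX 0%N; exact.
  by rewrite /= le_max IH.
have ndM w : {homo (fun n => M n w) : n m / (n <= m)%N >-> (n <= m)%E}.
  apply: (@homo_leq _ _ (fun x y => (x <= y)%E)) => [x|y x z|n]; first exact: lexx.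
    exact: le_trans.
  by rewrite /= le_max lexx.
have cM w : (fun n => M n w) @ \oo --> supn X w.
  have := ereal_nondecreasing_cvgn (ndM w).
  rewrite -/(supn M w); suff -> : supn M w = supn X w by [].
  apply/eqP; rewrite eq_le; apply/andP; split; apply: supn_lub => n.
    elim: n => [|n IH]; first exact: supn_ub.
    by rewrite /= ge_max IH supn_ub.
  apply: le_trans (supn_ub M n w).
  by case: n => [|n] //=; rewrite le_max lexx orbT.
have -> : (\int[P]_(w in B) supn X w =
    limn (fun n => \int[P]_(w in B) M n w))%E.
  rewrite -monotone_convergence//; last by move=> n; exact: measurable_funTS.
  by apply: eq_integral => w _; apply/esym/cvg_lim => //; exact: cM.
apply: lime_le.
  apply: ereal_nondecreasing_is_cvgn => n m nm.
  apply: ge0_le_integral => //; try exact: measurable_funTS.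
  by move=> w _; exact: ndM.
apply: nearW => n; have [Z [mZ XnZ Zc]] := XZ n.
apply: le_trans Zc; apply: le_integral_ae => //.
  exact/nonneg_rv_measurableE.
have : forall m, (m <= n)%N -> \forall w \ae P, (M m w <= Z w)%E.
  elim=> [|m IH] mn; first exact: XnZ.
  have := IH (ltnW mn); have := XnZ _ mn; apply: filterS2 => w Xw Mw.
  by rewrite /= ge_max Xw Mw.
by move=> /(_ n (leqnn n)); apply: filterS.
Qed.

(** * Existence of conditional expectations *)

Section existence.
Variables (G : set (set Omega)) (sG : sub_sigma_algebra_of G).

Let sub_measurable (A : set (g_sigma_algebraType G)) :
  measurable A -> measurable (A : set Omega).
Proof. by rewrite (sub_sigma_algebra_measurableE sG); exact: (proj2 sG). Qed.

Definition restricted_probability : set (g_sigma_algebraType G) -> \bar R :=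
  fun A => P A.

Let restricted0 : restricted_probability set0 = 0%E.
Proof. exact: measure0. Qed.

Let restricted_ge0 A : (0 <= restricted_probability A)%E.
Proof. exact: measure_ge0. Qed.

Let restricted_sigma_additive : semi_sigma_additive restricted_probability.
Proof.
move=> F mF tF mUF; apply: measure_semi_sigma_additive => //.
  by move=> n; exact: sub_measurable.
exact: sub_measurable.
Qed.

HB.instance Definition _ := isMeasure.Build _ _ _ restricted_probability
  restricted0 restricted_ge0 restricted_sigma_additive.

Let restrictedT : restricted_probability setT = 1%E.
Proof. exact: probability_setT. Qed.

HB.instance Definition _ := Measure_isProbability.Build _ _ _
  restricted_probability restrictedT.

(** Change of variables along the identity map from Omega, with all its
    measurable sets, to Omega with the events of G. *)
Lemma integral_restricted A Y : G A -> nonneg_rv G Y ->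
  (\int[restricted_probability]_(w in A) Y w = \int[P]_(w in A) Y w)%E.
Proof.
move=> GA [mY Y0].
have mid : measurable_fun [set: Omega]
    (id : Omega -> g_sigma_algebraType G).
  by move=> _ B mB; rewrite setTI; exact: sub_measurable.
have -> := @ge0_integral_pushforward _ _ _ _ _ _ mid P A Y _ _ _ => //.
  by rewrite (sub_sigma_algebra_measurableE sG).
exact: measurable_funTS.
Qed.

Section bounded.
Variables (X : Omega -> \bar R) (k : R).
Hypothesis (mX : nonneg_rv measurable X) (Xk : forall w, (X w <= k%:E)%E).

Definition integral_measure : set (g_sigma_algebraType G) -> \bar R :=
  fun A => (\int[P]_(w in A) X w)%E.

Let X0 w : (0 <= X w)%E. Proof. by case: mX. Qed.
Let mfX : measurable_fun [set: Omega] X.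
Proof. by have /nonneg_rv_measurableE[] := mX. Qed.

Let integral_measure0 : integral_measure set0 = 0%E.
Proof. exact: integral_set0. Qed.

Let integral_measure_ge0 A : (0 <= integral_measure A)%E.
Proof. exact: integral_ge0. Qed.

Let integral_measure_sigma_additive : semi_sigma_additive integral_measure.
Proof.
move=> F mF tF mUF; apply: semi_sigma_additive_nng_induced => //.
  by move=> n; exact: sub_measurable.
exact: sub_measurable.
Qed.

HB.instance Definition _ := isMeasure.Build _ _ _ integral_measure
  integral_measure0 integral_measure_ge0 integral_measure_sigma_additive.

Let integral_measure_fin : fin_num_fun integral_measure.
Proof.
move=> A /sub_measurable mA; rewrite ge0_fin_numE; last exact: integral_ge0.
apply: (@le_lt_trans _ _ (\int[P]_(w in A) (cst k%:E) w)%E).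
  by apply: ge0_le_integral => //; exact: measurable_funTS.
by rewrite integral_cst// ltey_eq fin_numM// fin_num_measure.
Qed.

HB.instance Definition _ := Measure_isFinite.Build _ _ _ integral_measure
  integral_measure_fin.

(** The bound makes A |-> \int_A X a finite measure on G, dominated by the
    restriction of P; its density is the conditional expectation. *)
Lemma is_cond_exp_bounded : exists Y, is_cond_exp P G X Y.
Proof.
have dom : integral_measure `<< restricted_probability.
  apply/null_content_dominatesP => A /sub_measurable mA A0.
  by apply: null_set_integral => //; exact: measurable_funTS.
have [f [f0 _ intf fE]] := radon_nikodym_sigma_finite dom.
have Gf : nonneg_rv G f by split => //; exact: measurable_int intf.
exists f; split => // A GA; rewrite -integral_restricted// -fE//.
by rewrite (sub_sigma_algebra_measurableE sG).
Qed.
End bounded.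

(** The conditional expectations of the truncations min (X, n) are almost surely
    increasing in n; their supremum has the right integrals by monotone
    convergence, applied once on each side. *)
Lemma is_cond_exp_exists X : nonneg_rv measurable X ->
  exists Y, is_cond_exp P G X Y.
Proof.
move=> /nonneg_rv_measurableE[mX X0].
pose Xn n w := mine (X w) n%:R%:E.
have mXn n : nonneg_rv measurable (Xn n).
  apply/nonneg_rv_measurableE; split; first exact: measurable_mine.
  by move=> w; rewrite le_min X0 lee_fin ler0n.
have bXn n w : (Xn n w <= n%:R%:E)%E by rewrite /Xn ge_min lexx orbT.
have [Y YE] := choice (fun n => is_cond_exp_bounded (mXn n) (bXn n)).
have GY n : nonneg_rv G (Y n) by case: (YE n).
have GsY := nonneg_rv_supn GY.
have ndXn i n w : (i <= n)%N -> (Xn i w <= Xn n w)%E.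
  by move=> ni; rewrite le_min ge_min lexx/= ge_min lee_fin ler_nat ni orbT.
have ndY i n : (i <= n)%N -> \forall w \ae P, (Y i w <= Y n w)%E.
  move=> ni; apply: (ae_le_of_integral sG) => // A GA.
  rewrite (proj2 (YE i) _ GA) (proj2 (YE n) _ GA); apply: le_integral_ae => //.
    exact: (proj2 sG).
  by apply: aeW => w _; exact: ndXn.
have XE : X = supn Xn.
  apply/funext => w; apply/eqP; rewrite eq_le; apply/andP; split; last first.
    by apply: supn_lub => n; rewrite ge_min lexx.
  have [Xfin|] := boolP (X w \is a fin_num).
    apply: le_trans (supn_ub Xn (Num.truncn (fine (X w))).+1 w).
    by rewrite le_min lexx/= -[leLHS]fineK// lee_fin ltW// truncnS_gt.
  rewrite ge0_fin_numE// -leNgt leye_eq => /eqP Xy; rewrite Xy leye_eq.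
  apply/eqP/eqyP => r r0; apply: le_trans (supn_ub Xn (Num.truncn r).+1 w).
  by rewrite /Xn Xy min_r ?leey// lee_fin ltW// truncnS_gt.
exists (supn Y); split => // A GA; have mA := proj2 sG _ GA.
apply/eqP; rewrite eq_le; apply/andP; split.
  apply: integral_supn_le => // [n|n]; first exact: nonneg_rvW (GY n).
  exists (Y n); split => //; first exact: nonneg_rvW (GY n).
    by move=> i; exact: ndY.
  rewrite (proj2 (YE n) _ GA); apply: le_integral_ae => //.
    exact/nonneg_rv_measurableE.
  by apply: aeW => w _; rewrite ge_min lexx.
rewrite [leLHS](eq_integral (supn Xn)); last by move=> w _; rewrite -XE.
apply: integral_supn_le => // n; exists (Xn n); split => //.
  by move=> i ni; apply: aeW => w; exact: ndXn.
rewrite -(proj2 (YE n) _ GA); apply: le_integral_ae => //.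
- exact: nonneg_rvW (GY n).
- exact: nonneg_rvW GsY.
- by apply: aeW => w _; exact: supn_ub.
Qed.

Lemma cond_expP X : nonneg_rv measurable X ->
  is_cond_exp P G X (cond_exp P G X).
Proof. by move=> /is_cond_exp_exists; exact: xgetPex. Qed.

End existence.

(** * Existence of essential suprema *)

(** For a rational q, let s q be the least upper bound of the probabilities that
    the supremum of a sequence in K exceeds q.  Merging countably many near-optimal sequences gives
    a single X attaining s q for every q.  A member Z of K exceeding supn X with
    positive probability would do so across some rational q, and adjoining Z to X
    would beat s q. *)
Lemma is_esssup_supn (K : set (Omega -> \bar R)) :
  K !=set0 -> (forall X, K X -> nonneg_rv measurable X) ->
  exists X : nat -> Omega -> \bar R,
    (forall n, K (X n)) /\ is_esssup P K (supn X).
Proof.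
move=> [X0 KX0] mK.
pose above (X : nat -> Omega -> \bar R) (q : rat) :=
  [set w | ((ratr q)%:E < supn X w)%E].
have m_gt (Y : Omega -> \bar R) (q : rat) : nonneg_rv measurable Y ->
    measurable [set w | ((ratr q)%:E < Y w)%E].
  move=> /nonneg_rv_measurableE[mY _].
  have := measurable_lte measurableT (measurable_cst (ratr q : R)%:E) mY.
  by rewrite setTI.
have m_above (X : nat -> Omega -> \bar R) q :
    (forall n, K (X n)) -> measurable (above X q).
  by move=> KX; apply: m_gt; apply: nonneg_rv_supn => n; exact: mK.
pose s (q : rat) := ereal_sup
  [set P (above X q) | X in [set X : nat -> Omega -> \bar R | forall n, K (X n)]].
have s_ub (X : nat -> Omega -> \bar R) q :
    (forall n, K (X n)) -> (P (above X q) <= s q)%E.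
  by move=> KX; apply: ereal_sup_ubound; exists X.
have s_fin q : s q \is a fin_num.
  rewrite fin_numElt; apply/andP; split.
    apply: lt_le_trans (s_ub (fun=> X0) q _) => //.
    by rewrite ltNye_eq fin_num_measure//; exact: m_above.
  apply: (@le_lt_trans _ _ 1%E); last exact: ltry.
  by apply: ge_ereal_sup => _ [X KX <-]; apply: probability_le1; exact: m_above.
have approx (qk : rat * nat) : exists X : nat -> Omega -> \bar R,
    (forall n, K (X n)) /\ (s qk.1 - (qk.2.+1%:R^-1)%:E < P (above X qk.1))%E.
  have e0 : 0 < qk.2.+1%:R^-1 :> R by rewrite invr_gt0 ltr0n.
  have [_ [X KX <-] sX] := ub_ereal_sup_adherent e0 (s_fin qk.1).
  by exists X.
have [F FE] := choice approx.
(* One sequence listing every term of every F (q, k). *)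
pose X n := if unpickle n is Some qkm then F (qkm.1.1, qkm.1.2) qkm.2 else X0.
have KX n : K (X n).
  by rewrite /X; case: unpickle => [[qk m]|//]; have [+ _] := FE (qk.1, qk.2); exact.
have FX qk m w : (F qk m w <= supn X w)%E.
  apply: le_trans (supn_ub X (pickle (qk, m)) w).
  by rewrite /X pickleK/= -surjective_pairing.
have s_attained q : (s q <= P (above X q))%E.
  apply/lee_addgt0Pr => e e0.
  pose k := Num.truncn e^-1.
  have [KF sF] := FE (q, k).
  have ke : (k.+1%:R^-1 <= e)%R.
    by rewrite -[leRHS]invrK lef_pV2 ?posrE ?invr_gt0// ltW// truncnS_gt.
  rewrite -leeBlDr//; apply: (@le_trans _ _ (P (above (F (q, k)) q))).
    by apply: le_trans (ltW sF); rewrite leeB// lee_fin.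
  apply: le_measure; rewrite ?inE; [exact: m_above|exact: m_above|].
  by move=> w /= /lt_le_trans; apply; apply: supn_lub => m; exact: FX.
exists X; split => //.
have mX : nonneg_rv measurable (supn X) by apply: nonneg_rv_supn => n; exact: mK.
split => // [Z KZ|Z mZ XZ]; last first.
  have : \forall w \ae P, forall n, (X n w <= Z w)%E.
    by apply: ae_foralln => n; exact: XZ.
  by apply: filterS => w; exact: supn_lub.
have mZ := mK _ KZ.
pose ZX n := if n is m.+1 then X m else Z.
have KZX n : K (ZX n) by case: n.
have nB q : P.-negligible ([set w | ((ratr q)%:E < Z w)%E] `\` above X q).
  have mB := measurableD (m_gt _ q mZ) (m_above _ q KX).
  apply/(negligibleP _) => //.
  have mU := measurableU _ _ (m_above _ q KX) mB.
  have : (P (above X q `|` ([set w | ((ratr q)%:E < Z w)%E] `\` above X q))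
      <= P (above X q))%E.
    apply: le_trans (s_attained q); apply: le_trans (s_ub _ q KZX).
    apply: le_measure; rewrite ?inE//; first exact: m_above.
    move=> w [|[Zw _]] /=.
      move=> /lt_le_trans; apply; apply: supn_lub => n.
      exact: (supn_ub ZX n.+1).
    by apply: lt_le_trans Zw _; exact: (supn_ub ZX 0%N).
  rewrite measureU//; [|exact: m_above|]; last first.
    by apply/seteqP; split => // w [? [_]].
  rewrite -[leRHS]adde0 leeD2lE; last by rewrite fin_num_measure//; exact: m_above.
  by rewrite measure_le0 => /eqP.
pose B n := if unpickle n is Some q then
  [set w | ((ratr q)%:E < Z w)%E] `\` above X q else set0.
have : P.-negligible (\bigcup_n B n).
  by apply: negligible_bigcup => n; rewrite /B; case: unpickle => //; exact: negligible_set0.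
apply: negligibleS => w /= /negP; rewrite -ltNge => XZ.
have X_ge0 : (0 <= supn X w)%E by case: mX.
have Xf : supn X w \is a fin_num.
  by rewrite ge0_fin_numE//; exact: lt_le_trans XZ (leey _).
suff [q [Xq qZ]] : exists q : rat, (supn X w <= (ratr q)%:E)%E /\ ((ratr q)%:E < Z w)%E.
  exists (pickle q) => //; rewrite /B pickleK; split => //.
  by rewrite /above/= ltNge Xq.
move: XZ; case: (Z w) => [z| |]; last by rewrite ltNge leNye.
  rewrite -(fineK Xf) lte_fin => /rat_in_itvoo[q]; rewrite in_itv/= => /andP[Xq qz].
  by exists q; rewrite lee_fin lte_fin ltW.
(* When Z w is infinite, any integer above supn X w serves as q. *)
move=> _; exists (Num.truncn (fine (supn X w))).+1%:R; split; last exact: ltry.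
by rewrite -(fineK Xf) lee_fin ratr_nat ltW// truncnS_gt.
Qed.

Lemma esssupP (K : set (Omega -> \bar R)) :
  K !=set0 -> (forall X, K X -> nonneg_rv measurable X) ->
  is_esssup P K (esssup P K).
Proof.
move=> K0 mK; have [X [_ XK]] := is_esssup_supn K0 mK.
by apply: xgetPex; exists (supn X).
Qed.

Lemma esssup_le_supn (K : set (Omega -> \bar R)) :
  K !=set0 -> (forall X, K X -> nonneg_rv measurable X) ->
  exists X : nat -> Omega -> \bar R, (forall n, K (X n)) /\
    \forall w \ae P, (esssup P K w <= supn X w)%E.
Proof.
move=> K0 mK; have [X [KX [mX XK _]]] := is_esssup_supn K0 mK.
exists X; split => //; have [_ _] := esssupP K0 mK; exact.
Qed.
End conditional_expectation.

(** * Stopping times and the events prior to them *)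

Section stopping_times.
Context {R : realType} {d : measure_display} {Omega : measurableType d}.
Variables (P : probability Omega R) (T : R) (F : R -> set (set Omega)).
Hypotheses (T_ge0 : 0 <= T) (F_filtration : filtration T F)
  (F_usual : usual_conditions P T F).
Implicit Types (S theta tau : Omega -> R) (A B : set Omega).
Local Notation T0 := (T0 T F).
Local Notation Tfrom := (Tfrom P T F).
Local Notation Fstop := (Fstop T F).

Lemma sub_sigma_algebra_filtration t : 0 <= t <= T -> sub_sigma_algebra_of (F t).
Proof.
move=> /[dup] tT /andP[t0 tleT]; split; first exact: filtration_sigma tT.
rewrite -(filtration_last F_filtration).
exact: (filtration_homo F_filtration t0 tleT (lexx _)).
Qed.

Lemma filtration_null t N : 0 <= t <= T -> measurable N -> P N = 0%E -> F t N.
Proof.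
move=> /andP[t0 tT] mN N0; apply: (filtration_homo F_filtration _ t0 tT) => //.
exact: (augmented F_usual).
Qed.

Lemma sub_sigma_algebra_Fstop tau : T0 tau -> sub_sigma_algebra_of (Fstop tau).
Proof.
have TT : 0 <= T <= T by rewrite T_ge0 lexx.
have sT := sub_sigma_algebra_filtration TT.
move=> [_ tauF]; split; last first.
  by move=> A [FA _]; rewrite -(filtration_last F_filtration).
split.
- split; first by case: (proj1 sT).
  move=> t tT; rewrite set0I.
  by case: (proj1 (sub_sigma_algebra_filtration tT)).
- move=> A [FA tA]; rewrite setTD; split; first exact: sub_sigma_algebraC.
  move=> t tT; have st := sub_sigma_algebra_filtration tT.
  have -> : ~` A `&` [set w | tau w <= t] =
      ~` (A `&` [set w | tau w <= t]) `&` [set w | tau w <= t].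
    by rewrite setCI setIUl setICl setU0.
  apply: sub_sigma_algebraI => //; last exact: tauF.
  by apply: sub_sigma_algebraC => //; exact: tA.
- move=> A FA; split.
    by case: (proj1 sT) => _ _; apply => n; case: (FA n).
  move=> t tT; rewrite setI_bigcupl.
  case: (proj1 (sub_sigma_algebra_filtration tT)) => _ _; apply => n.
  by case: (FA n) => _; exact.
Qed.

(** As S <= theta holds only almost surely, an event prior to S may differ, inside
    {theta <= t}, from an event of F t by a part of {theta < S}; that part is null,
    hence in F t by augmentation. *)
Lemma Fstop_homo S theta : T0 S -> T0 theta ->
  (\forall w \ae P, S w <= theta w) -> Fstop S `<=` Fstop theta.
Proof.
move=> TS Ttheta Stheta A /[dup] SA [FA tA]; split => // t tT.
have st := sub_sigma_algebra_filtration tT.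
have Ft_theta := proj2 Ttheta _ tT; have Ft_S := proj2 TS _ tT.
have mA := proj2 (sub_sigma_algebra_Fstop TS) _ SA.
pose N := A `&` [set w | theta w <= t] `&` ~` [set w | S w <= t].
have mN : measurable N.
  apply: measurableI; last by apply: measurableC; exact: (proj2 st).
  by apply: measurableI => //; exact: (proj2 st).
have -> : A `&` [set w | theta w <= t] =
    A `&` [set w | S w <= t] `&` [set w | theta w <= t] `|` N.
  apply/seteqP; split => [w [Aw tw]|w [[[Aw _] tw]|[[Aw tw] _]]]//.
  by have [?|?] := pselect (S w <= t); [left|right].
apply: sub_sigma_algebraU => //.
  by apply: sub_sigma_algebraI => //; exact: tA.
apply: filtration_null => //; apply/(negligibleP _) => //.
apply: negligibleS Stheta => w [[_ /= tw] nS] Sw; apply: nS.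
exact: le_trans Sw tw.
Qed.

Lemma Tfrom_refl S : T0 S -> Tfrom S S.
Proof. by move=> TS; split => //; exact: aeW. Qed.

Lemma Tfrom_trans S theta tau : Tfrom S theta -> Tfrom theta tau -> Tfrom S tau.
Proof.
move=> [_ St] [Ttau ttau]; split => //; move: St ttau.
by apply: filterS2 => w; exact: le_trans.
Qed.

(** The strategy that follows tau on the event A and tau' off it. *)
Definition paste A tau tau' : Omega -> R :=
  fun w => if `[< A w >] then tau w else tau' w.

Lemma paste_in A tau tau' w : A w -> paste A tau tau' w = tau w.
Proof. by move=> Aw; rewrite /paste asboolT. Qed.

Lemma paste_out A tau tau' w : ~ A w -> paste A tau tau' w = tau' w.
Proof. by move=> Aw; rewrite /paste asboolF. Qed.

Lemma Tfrom_paste theta tau tau' A : T0 theta -> Fstop theta A ->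
  Tfrom theta tau -> Tfrom theta tau' -> Tfrom theta (paste A tau tau').
Proof.
move=> Ttheta FA [Ttau ttau] [Ttau' ttau']; split; last first.
  by move: ttau ttau'; apply: filterS2 => w tw t'w; rewrite /paste; case: asboolP.
split=> [w|t tT].
  by rewrite /paste; case: asboolP => _; [case: Ttau|case: Ttau'].
have st := sub_sigma_algebra_filtration tT.
have -> : [set w | paste A tau tau' w <= t] =
    A `&` [set w | tau w <= t] `|` ~` A `&` [set w | tau' w <= t].
  apply/seteqP; split => w /=; rewrite /paste; case: asboolP => Aw.
  - by left.
  - by right.
  - by case=> -[].
  - by case=> -[].
apply: sub_sigma_algebraU => //.
  by have [_] := Fstop_homo Ttheta Ttau ttau FA; exact.
have FCA : Fstop theta (~` A).
  by apply: sub_sigma_algebraC => //; exact: sub_sigma_algebra_Fstop.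
by have [_] := Fstop_homo Ttheta Ttau' ttau' FCA; exact.
Qed.

Lemma T0_min tau tau' : T0 tau -> T0 tau' -> T0 (fun w => Num.min (tau w) (tau' w)).
Proof.
move=> [btau Ftau] [btau' Ftau']; split=> [w|t tT].
  have /andP[t0 tT] := btau w; have /andP[t0' tT'] := btau' w.
  by rewrite le_min t0 t0' ge_min tT.
have -> : [set w | Num.min (tau w) (tau' w) <= t] =
    [set w | tau w <= t] `|` [set w | tau' w <= t].
  by apply/seteqP; split => w /=; rewrite ge_min => /orP.
have st := sub_sigma_algebra_filtration tT.
by apply: sub_sigma_algebraU; [|exact: Ftau|exact: Ftau'].
Qed.

Lemma Tfrom_min S tau tau' : Tfrom S tau -> Tfrom S tau' ->
  Tfrom S (fun w => Num.min (tau w) (tau' w)).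
Proof.
move=> [Ttau Stau] [Ttau' Stau']; split; first exact: T0_min.
by move: Stau Stau'; apply: filterS2 => w Sw Sw'; rewrite le_min Sw Sw'.
Qed.

(** Inside {tau <= t}, the event {tau' < tau} is witnessed by a rational q between
    tau' and tau, necessarily in [0, t], for which {tau' <= q} and {tau > q} are
    both in F t. *)
Lemma Fstop_min_le tau tau' : T0 tau -> T0 tau' ->
  Fstop (fun w => Num.min (tau w) (tau' w)) [set w | tau w <= tau' w].
Proof.
move=> [btau Ftau] [btau' Ftau'].
suff FA t : 0 <= t <= T ->
    F t ([set w | tau w <= tau' w] `&` [set w | Num.min (tau w) (tau' w) <= t]).
  split => //.
  have := FA T; rewrite T_ge0 lexx => /(_ isT); congr (F T); apply/setIidPl => w _ /=.
  by rewrite ge_min; case/andP: (btau w) => _ ->.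
move=> tT; have st := sub_sigma_algebra_filtration tT.
pose C n := if unpickle n is Some q then
  if 0 <= (ratr q : R) <= t then
    [set w | tau' w <= ratr q] `&` ~` [set w | tau w <= ratr q]
  else set0 else set0.
have F0 : F t set0 by case: (proj1 st).
have FC n : F t (C n).
  rewrite /C; case: unpickle => // q; case: ifPn => // /andP[q0 qt].
  have /andP[t0 tleT] := tT.
  have qT : 0 <= (ratr q : R) <= T by rewrite q0 (le_trans qt).
  apply: sub_sigma_algebraI => //; last apply: sub_sigma_algebraC => //.
    exact: (filtration_homo F_filtration q0 qt tleT (Ftau' _ qT)).
  exact: (filtration_homo F_filtration q0 qt tleT (Ftau _ qT)).
have -> : [set w | tau w <= tau' w] `&` [set w | Num.min (tau w) (tau' w) <= t] =
    [set w | tau w <= t] `&` ~` \bigcup_n C n.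
  apply/seteqP; split => w /=.
    move=> [ww]; rewrite min_l// => wt; split => // -[n _]; rewrite /C.
    case: unpickle => // q; case: ifPn => // _ [/= t'q]; apply.
    exact: le_trans ww t'q.
  move=> [wt nC]; suff ww : tau w <= tau' w by rewrite min_l.
  rewrite leNgt; apply/negP => /rat_in_itvoo[q]; rewrite in_itv/= => /andP[t'q qt].
  apply: nC; exists (pickle q); [by []|]; rewrite /C pickleK ifT; last first.
    have /andP[t'0 _] := btau' w.
    by rewrite (le_trans t'0 (ltW t'q)) (le_trans (ltW qt) wt).
  by split => /=; [exact: ltW|apply/negP; rewrite -ltNge].
apply: sub_sigma_algebraI => //; first exact: Ftau.
apply: sub_sigma_algebraC => //.
by case: (proj1 st) => _ _; apply.
Qed.

Lemma T0_max tau tau' : T0 tau -> T0 tau' -> T0 (fun w => Num.max (tau w) (tau' w)).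
Proof.
move=> [btau Ftau] [btau' Ftau']; split=> [w|t tT].
  have /andP[t0 tT] := btau w; have /andP[t0' tT'] := btau' w.
  by rewrite ge_max tT tT' le_max t0.
have -> : [set w | Num.max (tau w) (tau' w) <= t] =
    [set w | tau w <= t] `&` [set w | tau' w <= t].
  by apply/seteqP; split => w /=; rewrite ge_max => /andP.
have st := sub_sigma_algebra_filtration tT.
by apply: sub_sigma_algebraI; [|exact: Ftau|exact: Ftau'].
Qed.

(** * The double stopping problem *)

Section double_stopping.
Variable psi : (Omega -> R) -> (Omega -> R) -> Omega -> \bar R.
Hypothesis psi_biadmissible : biadmissible P T F psi.
Local Notation E := (fun theta X => cond_exp P (Fstop theta) X).

Lemma nonneg_rv_psi tau1 tau2 : T0 tau1 -> T0 tau2 ->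
  nonneg_rv measurable (psi tau1 tau2).
Proof.
move=> Ttau1 Ttau2; apply: nonneg_rvW (proj1 psi_biadmissible _ _ Ttau1 Ttau2).
exact/sub_sigma_algebra_Fstop/T0_max.
Qed.

Lemma integral_psi_eq tau1 tau2 tau1' tau2' B :
  T0 tau1 -> T0 tau2 -> T0 tau1' -> T0 tau2' -> measurable B ->
  (forall w, B w -> tau1 w = tau1' w /\ tau2 w = tau2' w) ->
  (\int[P]_(w in B) psi tau1 tau2 w = \int[P]_(w in B) psi tau1' tau2' w)%E.
Proof.
move=> T1 T2 T1' T2' mB BE.
have /nonneg_rv_measurableE[mpsi psi0] := nonneg_rv_psi T1 T2.
have /nonneg_rv_measurableE[mpsi' psi0'] := nonneg_rv_psi T1' T2'.
apply: ge0_ae_eq_integral => //; try exact: measurable_funTS.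
have := proj2 psi_biadmissible _ _ _ _ T1 T1' T2 T2'.
by apply: filterS => w psiE /BE[? ?]; exact: psiE.
Qed.

Lemma is_cond_exp_E theta X : T0 theta -> nonneg_rv measurable X ->
  is_cond_exp P (Fstop theta) X (E theta X).
Proof. by move=> /sub_sigma_algebra_Fstop stheta; exact: cond_expP. Qed.

Lemma nonneg_rv_E theta X : T0 theta -> nonneg_rv measurable X ->
  nonneg_rv measurable (E theta X).
Proof.
move=> Ttheta mX; have [GE _] := is_cond_exp_E Ttheta mX.
by apply: nonneg_rvW GE; exact: sub_sigma_algebra_Fstop.
Qed.

Lemma is_esssup_v S : T0 S -> is_esssup P
  [set E S (psi tau1 tau2) | tau1 in Tfrom S & tau2 in Tfrom S] (v P T F psi S).
Proof.
move=> TS; apply: esssupP.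
  by eexists; exists S; [exact: Tfrom_refl|]; exists S; [exact: Tfrom_refl|].
by move=> _ [t1 [T1 _]] [t2 [T2 _] <-]; apply: nonneg_rv_E => //; exact: nonneg_rv_psi.
Qed.

Lemma is_esssup_u1 theta : T0 theta -> is_esssup P
  [set E theta (psi tau1 theta) | tau1 in Tfrom theta] (u1 P T F psi theta).
Proof.
move=> Ttheta; apply: esssupP.
  by eexists; exists theta; [exact: Tfrom_refl|].
by move=> _ [t1 [T1 _] <-]; apply: nonneg_rv_E => //; exact: nonneg_rv_psi.
Qed.

Lemma is_esssup_u2 theta : T0 theta -> is_esssup P
  [set E theta (psi theta tau2) | tau2 in Tfrom theta] (u2 P T F psi theta).
Proof.
move=> Ttheta; apply: esssupP.
  by eexists; exists theta; [exact: Tfrom_refl|].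
by move=> _ [t2 [T2 _] <-]; apply: nonneg_rv_E => //; exact: nonneg_rv_psi.
Qed.

Lemma nonneg_rv_phi theta : T0 theta -> nonneg_rv measurable (phi P T F psi theta).
Proof.
move=> Ttheta; have [/nonneg_rv_measurableE[m1 ge0] _ _] := is_esssup_u1 Ttheta.
have [/nonneg_rv_measurableE[m2 _] _ _] := is_esssup_u2 Ttheta.
apply/nonneg_rv_measurableE; split; first exact: measurable_maxe.
by move=> w; rewrite /phi le_max ge0.
Qed.

Lemma is_esssup_u S : T0 S -> is_esssup P
  [set E S (phi P T F psi theta) | theta in Tfrom S] (u P T F psi S).
Proof.
move=> TS; apply: esssupP.
  by eexists; exists S; [exact: Tfrom_refl|].
by move=> _ [t [Tt _] <-]; apply: nonneg_rv_E => //; exact: nonneg_rv_phi.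
Qed.

(** With theta = min (tau1, tau2), the reward psi tau1 tau2 is psi theta tau2 on
    {tau1 <= tau2} and psi tau1 theta off it, and the event is prior to theta.  The
    integral over an event prior to S, hence to theta, splits accordingly, and each
    piece is bounded by means of u2 theta or u1 theta. *)
Lemma v_le_u S : T0 S -> \forall w \ae P, (v P T F psi S w <= u P T F psi S w)%E.
Proof.
move=> TS; have [_ _ v_lub] := is_esssup_v TS; have [mu u_ub _] := is_esssup_u TS.
apply: v_lub => // _ [tau1 S1] [tau2 S2 <-].
have [T1 _] := S1; have [T2 _] := S2.
pose theta w := Num.min (tau1 w) (tau2 w).
have Stheta : Tfrom S theta by exact: Tfrom_min.
have [Ttheta leStheta] := Stheta.
have theta1 : Tfrom theta tau1.
  by split => //; apply: aeW => w; rewrite /theta ge_min lexx.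
have theta2 : Tfrom theta tau2.
  by split => //; apply: aeW => w; rewrite /theta ge_min lexx orbT.
have mpsi := nonneg_rv_psi T1 T2; have mphi := nonneg_rv_phi Ttheta.
have [GEpsi Epsi] := is_cond_exp_E TS mpsi.
have [GEphi Ephi] := is_cond_exp_E TS mphi.
have : \forall w \ae P, (E S (phi P T F psi theta) w <= u P T F psi S w)%E.
  by apply: u_ub; exists theta.
suff : \forall w \ae P,
    (E S (psi tau1 tau2) w <= E S (phi P T F psi theta) w)%E.
  by apply: filterS2 => w; exact: le_trans.
have stheta := sub_sigma_algebra_Fstop Ttheta.
have sS := sub_sigma_algebra_Fstop TS.
apply: (ae_le_of_integral sS GEpsi GEphi) => B SB; rewrite Epsi// Ephi//.
have thetaB := Fstop_homo TS Ttheta leStheta SB.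
have thetaA : Fstop theta [set w | tau1 w <= tau2 w] by exact: Fstop_min_le.
set A := [set w | _] in thetaA.
have mA := proj2 stheta _ thetaA; have mB := proj2 stheta _ thetaB.
have thetaBA : Fstop theta (B `&` A) by exact: sub_sigma_algebraI.
have thetaBD : Fstop theta (B `\` A).
  by apply: sub_sigma_algebraI => //; exact: sub_sigma_algebraC.
have mBA := proj2 stheta _ thetaBA; have mBD := proj2 stheta _ thetaBD.
rewrite (integral_splitI _ mA mB mpsi) (integral_splitI _ mA mB mphi).
apply: leeD.
  rewrite (@integral_psi_eq tau1 tau2 theta tau2)//; last first.
    by move=> w [_ A_w]; rewrite /theta min_l.
  have m2 := nonneg_rv_psi Ttheta T2.
  have [_ <-//] := is_cond_exp_E Ttheta m2.
  apply: le_integral_ae => //; first exact: nonneg_rv_E.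
  have [_ u2_ub _] := is_esssup_u2 Ttheta.
  have := u2_ub _ (ex_intro2 _ _ tau2 theta2 erefl).
  by apply: filterS => w Eu _; rewrite /phi le_max Eu orbT.
rewrite (@integral_psi_eq tau1 tau2 tau1 theta)//; last first.
  by move=> w [_ /negP]; rewrite -ltNge => lt21; rewrite /theta min_r// ltW.
have m1 := nonneg_rv_psi T1 Ttheta.
have [_ <-//] := is_cond_exp_E Ttheta m1.
apply: le_integral_ae => //; first exact: nonneg_rv_E.
have [_ u1_ub _] := is_esssup_u1 Ttheta.
have := u1_ub _ (ex_intro2 _ _ tau1 theta1 erefl).
by apply: filterS => w Eu _; rewrite /phi le_max Eu.
Qed.

Lemma phi_le_v theta : T0 theta ->
  \forall w \ae P, (phi P T F psi theta w <= v P T F psi theta w)%E.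
Proof.
move=> Ttheta; have [mv v_ub _] := is_esssup_v Ttheta.
have tt := Tfrom_refl Ttheta.
have : \forall w \ae P, (u1 P T F psi theta w <= v P T F psi theta w)%E.
  have [_ _ lub] := is_esssup_u1 Ttheta; apply: lub => // _ [tau1 t1 <-].
  by apply: v_ub; exists tau1 => //; exists theta.
have : \forall w \ae P, (u2 P T F psi theta w <= v P T F psi theta w)%E.
  have [_ _ lub] := is_esssup_u2 Ttheta; apply: lub => // _ [tau2 t2 <-].
  by apply: v_ub; exists theta => //; exists tau2.
by apply: filterS2 => w u2v u1v; rewrite /phi ge_max u1v.
Qed.

(** Follow p where its conditional reward is the larger one and q elsewhere: this
    event is prior to theta, so the pasted times are stopping times, and the
    pasted reward integrates as the maximum of the two conditional rewards. *)
Lemma cond_exp_psi_directed theta p1 p2 q1 q2 : T0 theta ->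
  Tfrom theta p1 -> Tfrom theta p2 -> Tfrom theta q1 -> Tfrom theta q2 ->
  exists r1 r2, [/\ Tfrom theta r1, Tfrom theta r2 &
    \forall w \ae P, (maxe (E theta (psi p1 p2) w) (E theta (psi q1 q2) w)
                      <= E theta (psi r1 r2) w)%E].
Proof.
move=> Ttheta tp1 tp2 tq1 tq2.
have stheta := sub_sigma_algebra_Fstop Ttheta.
have mp := nonneg_rv_psi (proj1 tp1) (proj1 tp2).
have mq := nonneg_rv_psi (proj1 tq1) (proj1 tq2).
have [Gp Ep] := is_cond_exp_E Ttheta mp; have [Gq Eq] := is_cond_exp_E Ttheta mq.
pose A := [set w | (E theta (psi q1 q2) w <= E theta (psi p1 p2) w)%E].
have thetaA : Fstop theta A.
  rewrite -(sub_sigma_algebra_measurableE stheta).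
  have := @measurable_lee _ (g_sigma_algebraType (Fstop theta)) R setT measurableT
    _ _ (proj1 Gq) (proj1 Gp).
  by rewrite setTI.
exists (paste A p1 q1), (paste A p2 q2).
have t1 := Tfrom_paste Ttheta thetaA tp1 tq1.
have t2 := Tfrom_paste Ttheta thetaA tp2 tq2.
split => //.
have mr := nonneg_rv_psi (proj1 t1) (proj1 t2).
have [Gr Er] := is_cond_exp_E Ttheta mr.
have Gmax : nonneg_rv (Fstop theta)
    (fun w => maxe (E theta (psi p1 p2) w) (E theta (psi q1 q2) w)).
  split; first by apply: measurable_maxe; [exact: (proj1 Gp)|exact: (proj1 Gq)].
  by move=> w; rewrite le_max (proj2 Gp).
apply: (ae_le_of_integral stheta) => // B thetaB; rewrite Er//.
have mA := proj2 stheta _ thetaA; have mB := proj2 stheta _ thetaB.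
have thetaBA : Fstop theta (B `&` A) by exact: sub_sigma_algebraI.
have thetaBD : Fstop theta (B `\` A).
  by apply: sub_sigma_algebraI => //; exact: sub_sigma_algebraC.
have mBA := proj2 stheta _ thetaBA; have mBD := proj2 stheta _ thetaBD.
rewrite (integral_splitI _ mA mB mr) (integral_splitI _ mA mB (nonneg_rvW stheta Gmax)).
have [T1 _] := t1; have [T2 _] := t2.
have [[P1 _] [P2 _] [Q1 _] [Q2 _]] := And4 tp1 tp2 tq1 tq2.
apply: leeD.
  rewrite (@integral_psi_eq _ _ p1 p2)//; last first.
    by move=> w [_ Aw]; rewrite !paste_in.
  rewrite -Ep// le_eqVlt; apply/predU1P; left.
  apply: eq_integral => w; rewrite inE => -[_ Aw].
  exact/max_idPl.
rewrite (@integral_psi_eq _ _ q1 q2)//; last first.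
  by move=> w [_ Aw]; rewrite !paste_out.
rewrite -Eq// le_eqVlt; apply/predU1P; left.
apply: eq_integral => w; rewrite inE => -[_ /negP].
by rewrite -ltNge => /ltW pq; exact/max_idPr.
Qed.

(** Directedness, iterated along an initial segment of a sequence of pairs. *)
Lemma cond_exp_psi_dominated theta (p : nat -> (Omega -> R) * (Omega -> R)) n :
  T0 theta -> (forall n, Tfrom theta (p n).1 /\ Tfrom theta (p n).2) ->
  exists r, [/\ Tfrom theta r.1, Tfrom theta r.2 & forall i, (i <= n)%N ->
    \forall w \ae P, (E theta (psi (p i).1 (p i).2) w <= E theta (psi r.1 r.2) w)%E].
Proof.
move=> Ttheta tp; elim: n => [|n [q [tq1 tq2 qE]]].
  exists (p 0%N); have [t1 t2] := tp 0%N; split => // i.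
  by rewrite leqn0 => /eqP ->; exact: aeW.
have [t1 t2] := tp n.+1.
have [r1 [r2 [tr1 tr2 rE]]] := cond_exp_psi_directed Ttheta tq1 tq2 t1 t2.
exists (r1, r2); split => // i; rewrite leq_eqVlt => /predU1P[->|].
  by move: rE; apply: filterS => w /=; rewrite ge_max => /andP[].
rewrite ltnS => /qE; move: rE; apply: filterS2 => w /=.
by rewrite ge_max => /andP[qr _] /le_trans; exact.
Qed.

(** v theta is the supremum of countably many conditional rewards, and the first n
    of them are dominated by a single pair r n.  Over an event prior to S, the
    reward of r n has the same integral whether conditioned at theta or at S, and
    the supremum W of the latter is F_S-measurable and below v S.  Working with W
    spares the F_S-measurability of v S, which is defined only up to null sets. *)
Lemma v_supermartingale S theta X : T0 S -> Tfrom S theta ->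
  nonneg_rv measurable X -> (\forall w \ae P, (X w <= v P T F psi theta w)%E) ->
  \forall w \ae P, (E S X w <= v P T F psi S w)%E.
Proof.
move=> TS Stheta mX Xv; have [Ttheta leStheta] := Stheta.
have sS := sub_sigma_algebra_Fstop TS.
have stheta := sub_sigma_algebra_Fstop Ttheta.
have [Y [KY vY]] : exists Y : nat -> Omega -> \bar R,
   (forall n, [set E theta (psi tau1 tau2) |
      tau1 in Tfrom theta & tau2 in Tfrom theta] (Y n)) /\
   \forall w \ae P, (v P T F psi theta w <= supn Y w)%E.
  apply: esssup_le_supn.
    by eexists; exists theta; [exact: Tfrom_refl|]; exists theta; [exact: Tfrom_refl|].
  move=> _ [t1 [T1 _]] [t2 [T2 _] <-].
  by apply: nonneg_rv_E => //; exact: nonneg_rv_psi.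
have Yp n : exists q : (Omega -> R) * (Omega -> R),
    [/\ Tfrom theta q.1, Tfrom theta q.2 & Y n = E theta (psi q.1 q.2)].
  by have [t1 T1 [t2 T2 <-]] := KY n; exists (t1, t2).
have [p pE] := choice Yp.
have tp n : Tfrom theta (p n).1 /\ Tfrom theta (p n).2 by have [] := pE n.
have [r rE] := choice (fun n => cond_exp_psi_dominated n Ttheta tp).
have mr n : nonneg_rv measurable (psi (r n).1 (r n).2).
  by have [[T1 _] [T2 _] _] := rE n; exact: nonneg_rv_psi.
pose W := supn (fun n => E S (psi (r n).1 (r n).2)).
have SW : nonneg_rv (Fstop S) W.
  by apply: nonneg_rv_supn => n; have [] := is_cond_exp_E TS (mr n).
have Wv : \forall w \ae P, (W w <= v P T F psi S w)%E.
  have [_ v_ub _] := is_esssup_v TS.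
  have : \forall w \ae P, forall n,
      (E S (psi (r n).1 (r n).2) w <= v P T F psi S w)%E.
    apply: ae_foralln => n; have [t1 t2 _] := rE n.
    apply: v_ub; exists (r n).1; first exact: Tfrom_trans t1.
    by exists (r n).2 => //; exact: Tfrom_trans t2.
  by apply: filterS => w; exact: supn_lub.
have mY n : nonneg_rv measurable (Y n).
  have [[T1 _] [T2 _] ->] := pE n.
  by apply: nonneg_rv_E => //; exact: nonneg_rv_psi.
suff : \forall w \ae P, (E S X w <= W w)%E.
  by move: Wv; apply: filterS2 => w Wv EW; exact: le_trans Wv.
have [GX EX] := is_cond_exp_E TS mX.
apply: (ae_le_of_integral sS) => // B SB; rewrite EX//.
have thetaB := Fstop_homo TS Ttheta leStheta SB.
have mB := proj2 sS _ SB.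
apply: (@le_trans _ _ (\int[P]_(w in B) supn Y w)%E).
  apply: le_integral_ae => //; first exact: nonneg_rv_supn.
  by move: Xv vY; apply: filterS2 => w Xv vY _; exact: le_trans vY.
apply: integral_supn_le => // n; exists (E theta (psi (r n).1 (r n).2)).
have [_ _ rY] := rE n.
split; first exact: nonneg_rv_E.
  by move=> i /rY; have [_ _ ->] := pE i.
have [_ ->//] := is_cond_exp_E Ttheta (mr n).
have [Gr <-//] := is_cond_exp_E TS (mr n).
apply: le_integral_ae => //; [exact: nonneg_rv_E|exact: nonneg_rvW SW|].
by apply: aeW => w _; exact: (supn_ub (fun n => E S (psi (r n).1 (r n).2))).
Qed.

Lemma u_le_v S : T0 S -> \forall w \ae P, (u P T F psi S w <= v P T F psi S w)%E.
Proof.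
move=> TS; have [_ _ u_lub] := is_esssup_u TS; have [mv _ _] := is_esssup_v TS.
apply: u_lub => // _ [theta Stheta <-]; have [Ttheta _] := Stheta.
apply: v_supermartingale => //; [exact: Stheta|exact: nonneg_rv_phi|exact: phi_le_v].
Qed.

End double_stopping.
End stopping_times.

Theorem mainTheorem2 (R : realType) (d : measure_display)
    (Omega : measurableType d) (P : probability Omega R)
    (T : R) (T_ge0 : 0 <= T)
    (F : R -> set (set Omega))
    (F_filtration : filtration T F)
    (F_usual : usual_conditions P T F)
    (F0_trivial : forall A, F 0 A -> P A = 0%E \/ P A = 1%E)
    (psi : (Omega -> R) -> (Omega -> R) -> Omega -> \bar R)
    (psi_biadmissible : biadmissible P T F psi)
    (S : Omega -> R) (S_T0 : T0 T F S) :
  \forall w \ae P, v P T F psi S w = u P T F psi S w.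
Proof.
have := v_le_u T_ge0 F_filtration F_usual psi_biadmissible S_T0.
have := u_le_v T_ge0 F_filtration F_usual psi_biadmissible S_T0.
by apply: filterS2 => w uv vu; apply/eqP; rewrite eq_le vu.
Qed.
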